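(* Let $d>1$ be an integer, let $x$ be an irrational real number and $y$ a real number. If the sets $\mathcal{P}_x^d=\{0,x,2x,\dots,(d-1)x\} \pmod 1$ and $\mathcal{P}_y^d=\{0,y,2y,\dots,(d-1)y\}\pmod 1$ are transpositionally equivalent, then $x=y \pmod 1$ or $x=-y\pmod 1$.
   Context: The sets $\mathcal{P}_x^d$ and $\mathcal{P}_y^d$ are regarded as subsets of $\mathbb{R}/\mathbb{Z}$. Two subsets $S,T$ of $\mathbb{R}/\mathbb{Z}$ are transpositionally equivalent if $S=T+\tau$ for some $\tau\in\mathbb{R}/\mathbb{Z}$. *)

(* Defs.v *)
From HB Require Import structures.
From mathcomp Require Import all_boot all_order all_algebra.
From mathcomp Require Import generic_quotient ring_quotient.
From mathcomp Require Import all_classical all_reals.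

Set Implicit Arguments.
Unset Strict Implicit.
Unset Printing Implicit Defensive.

Import Order.TTheory GRing.Theory Num.Theory.

Local Open Scope quotient_scope.
Local Open Scope classical_set_scope.
Local Open Scope ring_scope.

(* [Num.int_num_subdef] is the predicate underlying the qualifier [Num.int];
   it is the one that carries the subgroup structure. *)
Definition RmodZ (R : realType) : Type :=
  Quotient.quot (GRing.ZmodClosed.clone R Num.int_num_subdef _).

HB.instance Definition _ (R : realType) := ZmodQuotient.on (RmodZ R).

Lemma RmodZ_eqP (R : realType) (x y : R) :
  x = y %[mod RmodZ R] <-> x - y \is a Num.int.
Proof.
split; first by move/eqP; rewrite -Quotient.idealrBE.
by move=> xyZ; apply/eqP; rewrite -Quotient.idealrBE.
Qed.

Definition multiples_mod1 (R : realType) (d : nat) (x : R) : set (RmodZ R) :=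
  [set \pi_(RmodZ R) (k%:R * x) | k in [set k : nat | (k < d)%N]].

Definition transp_equiv (R : realType) (S T : set (RmodZ R)) : Prop :=
  exists tau : RmodZ R, S = [set t + tau | t in T].

(* Main.v *)
Require Import Defs.
From mathcomp Require Import all_boot all_order all_algebra.
From mathcomp Require Import generic_quotient ring_quotient.
From mathcomp Require Import all_classical all_reals.
From mathcomp Require Import zify.

(** Only the group structure of R/Z matters, together with the fact that the
    class a of an irrational number has infinite order (pi_mulrz_inj), so that
    the multiples of a form a copy of the integers.  Suppose that the
    progression 0, a, ..., (d-1)a is the translate by t of 0, b, ..., (d-1)b.
    Then t and t + b are multiples of a, hence b = n a for some integer n, and
    the equality of the two progressions becomes an equality of sets of
    integers: an interval of length d - 1 is covered by an arithmetic
    progression with d terms and common difference n.  As the interval has at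
    least two points, n <> 0; as the first and last terms of the progression
    both lie in the interval, |n| (d - 1) <= d - 1.  So n = 1 or n = -1, that
    is, b = a or b = - a (progression_step). *)

Import Order.TTheory GRing.Theory Num.Theory.

Local Open Scope quotient_scope.
Local Open Scope classical_set_scope.
Local Open Scope ring_scope.

(** Two equal-length progressions in an abelian group that are translates of
    each other have the same step up to sign, provided that one step has
    infinite order: the first two terms of the second progression locate its
    step b in the infinite cyclic group generated by a, and its first and last
    terms bound the coefficient of b there. *)
Lemma progression_step (G : zmodType) (a b t : G) (d : nat) :
  (1 < d)%N -> injective (fun n : int => a *~ n) ->
  [set a *+ k | k in [set k | (k < d)%N]] =
    [set u + t | u in [set b *+ k | k in [set k | (k < d)%N]]] ->
  a = b \/ a = - b.
Proof.
move=> d1 a_inj E.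
have d0 : (0 < d)%N by exact: ltnW.
have term j : (j < d)%N -> exists2 k, (k < d)%N & b *+ j + t = a *+ k.
  move=> jd; have : [set a *+ k | k in [set k | (k < d)%N]] (b *+ j + t).
    by rewrite E; exists (b *+ j) => //; exists j.
  by case=> k kd <-; exists k.
have [k0 k0d] := term 0%N d0; rewrite mulr0n add0r => t_k0.
have [k1 k1d] := term 1%N d1; rewrite mulr1n => b_k1.
pose n : int := k1%:Z - k0%:Z.
have bn : b = a *~ n by rewrite mulrzBr -!pmulrn -b_k1 -t_k0 addrK.
(* If n = 0, the right-hand progression is the single point t, while 0 and a
   are distinct terms of the left-hand one. *)
have n0 : n != 0.
  apply/eqP => n0.
  have at_t k : (k < d)%N -> a *+ k = t.
    move=> kd; have : [set a *+ k | k in [set k | (k < d)%N]] (a *+ k).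
      by exists k.
    by rewrite E => -[_ [j _ <-] <-]; rewrite bn n0 mulr0z mul0rn add0r.
  by have /a_inj : a *~ 0%:Z = a *~ 1%:Z by rewrite -!pmulrn !at_t.
have [m md] : exists2 m, (m < d)%N & b *+ d.-1 + t = a *+ m by apply: term; lia.
rewrite t_k0 bn !pmulrn -mulrzA -mulrzDr => /a_inj m_n.
(* Here k0 and m = n (d - 1) + k0 both lie in [0, d - 1], so |n| <= 1. *)
have [n1|n1] : n = 1 \/ n = -1 by nia.
- by left; rewrite n1 mulr1z.
- by right; rewrite n1 mulrNz mulr1z opprK.
Qed.

Lemma pi_mulrn (R : realType) (x : R) (k : nat) :
  \pi_(RmodZ R) (k%:R * x) = \pi_(RmodZ R) x *+ k.
Proof. by rewrite mulr_natl raddfMn. Qed.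

(** Infinite order of the class of an irrational x: if m x and n x agree modulo
    1 with m <> n, then (m - n) x is an integer z and x = z / (m - n) is
    rational. *)
Lemma pi_mulrz_inj (R : realType) (x : R) :
  irrational x -> injective (fun n : int => \pi_(RmodZ R) x *~ n).
Proof.
move=> xirr m n /=; rewrite -!raddfMz => /RmodZ_eqP.
rewrite -mulrzBr -mulrzl => /intrP[z xz]; apply/eqP; rewrite -subr_eq0.
apply/negPn/negP => mn0; apply: xirr; exists (z%:~R / (m - n)%:~R) => //.
by rewrite fmorph_div /= !ratr_int -xz mulrC mulKf // intr_eq0.
Qed.

Theorem theorem7 (R : realType) (d : nat) (x y : R) (hd : (1 < d)%N)
    (hx : @irrational R x)
    (hxy : transp_equiv (multiples_mod1 d x) (multiples_mod1 d y)) :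
  x = y %[mod RmodZ R] \/ x = - y %[mod RmodZ R].
Proof.
have multE z : multiples_mod1 d z =
    [set \pi_(RmodZ R) z *+ k | k in [set k | (k < d)%N]].
  by apply: eq_imagel => k _; rewrite pi_mulrn.
case: hxy => tau; rewrite !multE.
move=> /(progression_step _ _ _ _ _ hd (pi_mulrz_inj _ _ hx)).
by rewrite raddfN.
Qed.
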